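(* Let $(A,\cdot,\{~,~\})$ be a Poisson algebra and $R:A\to A$ be a Reynolds operator on $A$. Define bilinear operations $\ast,\curlyvee,\diamond,\bullet:A\times A\to A$ by $$x\ast y=R(x)\cdot y,\quad x\curlyvee y=-R(x)\cdot R(y),\quad x\diamond y=\{R(x),y\},\quad x\bullet y=-\{R(x),R(y)\},\qquad x,y\in A.$$ Then $(A,\ast,\curlyvee,\diamond,\bullet)$ is an NS-Poisson algebra.
   Context: All vector spaces and (multi)linear maps are over a field $\mathbf{k}$ of characteristic $0$. Associative algebras are not required to be unital. A Poisson algebra is a triple $(A,\cdot,\{~,~\})$ with $(A,\cdot)$ a commutative associative algebra and $\{~,~\}$ a Lie bracket on $A$ satisfying $\{x,y\cdot z\}=\{x,y\}\cdot z+y\cdot\{x,z\}$. A Reynolds operator on a Poisson algebra $(A,\cdot,\{~,~\})$ is a linear map $R:A\to A$ such that for all $x,y\in A$: $$R(x)\cdot R(y)=R\big(R(x)\cdot y+x\cdot R(y)-R(x)\cdot R(y)\big),\qquad \{R(x),R(y)\}=R\big(\{R(x),y\}+\{x,R(y)\}-\{R(x),R(y)\}\big).$$ An NS-commutative algebra is a triple $(A,\ast,\curlyvee)$ of a vector space $A$ with bilinear operations $\ast,\curlyvee$, where $\curlyvee$ is commutative, such that for all $x,y,z\in A$, with $x\odot y=x\ast y+y\ast x+x\curlyvee y$: $$x\ast(y\ast z)=(x\odot y)\ast z,\qquad x\ast(y\curlyvee z)+x\curlyvee(y\odot z)=y\ast(x\curlyvee z)+y\curlyvee(x\odot z).$$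 An NS-Lie algebra is a triple $(A,\diamond,\bullet)$ of a vector space $A$ with bilinear operations $\diamond,\bullet$, where $\bullet$ is skew-symmetric, such that for all $x,y,z\in A$, with $\{\!\!\{x,y\}\!\!\}=x\diamond y-y\diamond x+x\bullet y$: $$x\diamond(y\diamond z)-(x\diamond y)\diamond z-y\diamond(x\diamond z)+(y\diamond x)\diamond z=(x\bullet y)\diamond z,$$ $$x\bullet\{\!\!\{y,z\}\!\!\}+y\bullet\{\!\!\{z,x\}\!\!\}+z\bullet\{\!\!\{x,y\}\!\!\}+x\diamond(y\bullet z)+y\diamond(z\bullet x)+z\diamond(x\bullet y)=0.$$ An NS-Poisson algebra is a quintuple $(A,\ast,\curlyvee,\diamond,\bullet)$ such that $(A,\ast,\curlyvee)$ is an NS-commutative algebra, $(A,\diamond,\bullet)$ is an NS-Lie algebra, and for all $x,y,z\in A$, with $x\odot y=x\ast y+y\ast x+x\curlyvee y$ and $\{\!\!\{x,y\}\!\!\}=x\diamond y-y\diamond x+x\bullet y$: $$\{\!\!\{x,y\}\!\!\}\ast z=x\diamond(y\ast z)-y\ast(x\diamond z),$$ $$(x\odot y)\diamond z=x\ast(y\diamond z)+y\ast(x\diamond z),$$ $$x\bullet(y\odot z)+x\diamond(y\curlyvee z)=\{\!\!\{x,y\}\!\!\}\curlyvee z+z\ast(x\bullet y)+y\curlyvee\{\!\!\{x,z\}\!\!\}+y\ast(x\bullet z).$$ *)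

(* Defs.v *)
From mathcomp Require Import all_boot all_algebra.

Set Implicit Arguments.
Unset Strict Implicit.
Unset Printing Implicit Defensive.

Import GRing.Theory.
Local Open Scope ring_scope.

(* Algebra structures are predicates on plain binary operations of a vector
   space [A]; bilinearity is part of each predicate.  Products are not MathComp
   ring multiplications because algebras here need not be unital. *)

Notation bilinear_op op := (bilinear_for *:%R *:%R op).

Section Structures.
Variables (k : fieldType) (A : lmodType k).
Implicit Types mul br ast cur dia bul : A -> A -> A.

Record is_comm_assoc_algebra mul : Prop := IsCommAssocAlgebra {
  comm_assoc_bilinear : bilinear_op mul;
  comm_assoc_comm : commutative mul;
  comm_assoc_assoc : associative mul
}.

(* Antisymmetry is equivalent to [br x x = 0] in characteristic 0. *)
Record is_lie_bracket br : Prop := IsLieBracket {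
  lie_bilinear : bilinear_op br;
  lie_skew : forall x y, br x y = - br y x;
  lie_jacobi : forall x y z,
    br x (br y z) + br y (br z x) + br z (br x y) = 0
}.

Record is_poisson_algebra mul br : Prop := IsPoissonAlgebra {
  poisson_comm_assoc : is_comm_assoc_algebra mul;
  poisson_lie : is_lie_bracket br;
  poisson_leibniz : forall x y z,
    br x (mul y z) = mul (br x y) z + mul y (br x z)
}.

Record is_reynolds_operator mul br (R : {linear A -> A}) : Prop :=
  IsReynoldsOperator {
  reynolds_mul : forall x y,
    mul (R x) (R y) = R (mul (R x) y + mul x (R y) - mul (R x) (R y));
  reynolds_br : forall x y,
    br (R x) (R y) = R (br (R x) y + br x (R y) - br (R x) (R y))
}.

Definition ns_comm_total ast cur x y := ast x y + ast y x + cur x y.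

Record is_ns_commutative ast cur : Prop := IsNSCommutative {
  ns_comm_ast_bilinear : bilinear_op ast;
  ns_comm_cur_bilinear : bilinear_op cur;
  ns_comm_cur_comm : commutative cur;
  ns_comm_ast : forall x y z,
    ast x (ast y z) = ast (ns_comm_total ast cur x y) z;
  ns_comm_cur : forall x y z,
    ast x (cur y z) + cur x (ns_comm_total ast cur y z) =
    ast y (cur x z) + cur y (ns_comm_total ast cur x z)
}.

Definition ns_lie_total dia bul x y := dia x y - dia y x + bul x y.

Record is_ns_lie dia bul : Prop := IsNSLie {
  ns_lie_dia_bilinear : bilinear_op dia;
  ns_lie_bul_bilinear : bilinear_op bul;
  ns_lie_bul_skew : forall x y, bul x y = - bul y x;
  ns_lie_dia : forall x y z,
    dia x (dia y z) - dia (dia x y) z - dia y (dia x z) + dia (dia y x) z =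
    dia (bul x y) z;
  ns_lie_bul : forall x y z,
    bul x (ns_lie_total dia bul y z) + bul y (ns_lie_total dia bul z x)
    + bul z (ns_lie_total dia bul x y)
    + dia x (bul y z) + dia y (bul z x) + dia z (bul x y) = 0
}.

Record is_ns_poisson ast cur dia bul : Prop := IsNSPoisson {
  ns_poisson_comm : is_ns_commutative ast cur;
  ns_poisson_lie : is_ns_lie dia bul;
  ns_poisson_lie_ast : forall x y z,
    ast (ns_lie_total dia bul x y) z = dia x (ast y z) - ast y (dia x z);
  ns_poisson_comm_dia : forall x y z,
    dia (ns_comm_total ast cur x y) z = ast x (dia y z) + ast y (dia x z);
  ns_poisson_bul : forall x y z,
    bul x (ns_comm_total ast cur y z) + dia x (cur y z) =
    cur (ns_lie_total dia bul x y) z + ast z (bul x y)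
    + cur y (ns_lie_total dia bul x z) + ast y (bul x z)
}.

End Structures.

(* Main.v *)
Require Import Defs.
From mathcomp Require Import all_boot all_algebra.

Set Implicit Arguments.
Unset Strict Implicit.
Unset Printing Implicit Defensive.

Import GRing.Theory.
Local Open Scope ring_scope.

(** The Reynolds identities say exactly that [R] carries the total operations
    of the induced structure to the original ones: with [x (.) y] and
    [{{x, y}}] the total commutative and Lie products,
    [R (x (.) y) = R x . R y] and [R {{x, y}} = {R x, R y}]
    ([reynolds_ns_comm_total], [reynolds_ns_lie_total]).
    In the NS-axioms the argument of each outer operation that holds a total
    product is one that this operation sends through [R]; the first NS-Lie
    axiom takes this form once its terms acting on [z] by a product of [x] and
    [y] are collected.  After these two substitutions each axiom is a Poisson
    identity for [R x], [R y] and [z], or for [R x], [R y] and [R z] when [z]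
    also meets an operation that applies [R] to both of its arguments:
    - the NS-commutative axioms become associativity and commutativity;
    - the NS-Lie axioms become the Jacobi identity, which occurs twice in the
      second one;
    - the three compatibility axioms become the Leibniz rule: in the second
      argument of the bracket, in the first one, and for the last axiom twice
      the rule on [R x], [R y], [R z]. *)

Section BilinearOperations.
Variables (k : fieldType) (A : lmodType k) (op : A -> A -> A).
Hypothesis op_bilinear : bilinear_op op.

Lemma bilinear_opDl x y z : op (x + y) z = op x z + op y z.
Proof. by have := op_bilinear.1 z 1 x y; rewrite /= !scale1r. Qed.

Lemma bilinear_opDr x y z : op x (y + z) = op x y + op x z.
Proof. by have := op_bilinear.2 x 1 y z; rewrite /= !scale1r. Qed.

Lemma bilinear_opNl x y : op (- x) y = - op x y.
Proof.
have op0 : op 0 y = 0.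
  by apply: (addrI (op 0 y)); rewrite -bilinear_opDl !addr0.
by apply/eqP; rewrite -addr_eq0 -bilinear_opDl addNr op0.
Qed.

Lemma bilinear_opNr x y : op x (- y) = - op x y.
Proof.
have op0 : op x 0 = 0.
  by apply: (addrI (op x 0)); rewrite -bilinear_opDr !addr0.
by apply/eqP; rewrite -addr_eq0 -bilinear_opDr addNr op0.
Qed.

Lemma bilinear_op_precomp (R : {linear A -> A}) :
  bilinear_op (fun x y => op (R x) y).
Proof.
split=> [y a u v|x a u v] /=.
  by rewrite linearP; apply: op_bilinear.1.
exact: op_bilinear.2.
Qed.

Lemma bilinear_op_opp_precomp2 (R : {linear A -> A}) :
  bilinear_op (fun x y => - op (R x) (R y)).
Proof.
split=> [y a u v|x a u v] /=; rewrite linearP.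
  have /= -> := op_bilinear.1 (R y) a (R u) (R v).
  by rewrite opprD scalerN.
have /= -> := op_bilinear.2 (R x) a (R u) (R v).
by rewrite opprD scalerN.
Qed.

End BilinearOperations.

Section ReynoldsOperator.
Variables (k : fieldType) (A : lmodType k) (mul br : A -> A -> A).
Hypothesis poissonA : is_poisson_algebra mul br.
Variable R : {linear A -> A}.
Hypothesis reynoldsR : is_reynolds_operator mul br R.

Let mulA := comm_assoc_assoc (poisson_comm_assoc poissonA).
Let mulC := comm_assoc_comm (poisson_comm_assoc poissonA).
Let mul_bilinear := comm_assoc_bilinear (poisson_comm_assoc poissonA).
Let br_skew := lie_skew (poisson_lie poissonA).
Let br_bilinear := lie_bilinear (poisson_lie poissonA).
Let leibniz := poisson_leibniz poissonA.

Let ast x y := mul (R x) y.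
Let cur x y := - mul (R x) (R y).
Let dia x y := br (R x) y.
Let bul x y := - br (R x) (R y).

Lemma poisson_mulCA x y z : mul x (mul y z) = mul y (mul x z).
Proof. by rewrite mulA (mulC x y) -mulA. Qed.

(** The Jacobi identity, read through antisymmetry: bracketing on the left is
    a representation of the Lie algebra on itself. *)
Lemma poisson_br_adjoint x y z :
  br (br x y) z = br x (br y z) - br y (br x z).
Proof.
have := lie_jacobi (poisson_lie poissonA) x y z.
rewrite (br_skew z x) (bilinear_opNr br_bilinear) (br_skew z) => /eqP.
by rewrite subr_eq0 => /eqP ->.
Qed.

Lemma poisson_leibniz_left x y z :
  br (mul x y) z = mul x (br y z) + mul y (br x z).
Proof.
rewrite br_skew leibniz (br_skew z x) (br_skew z y).
rewrite (bilinear_opNl mul_bilinear) (bilinear_opNr mul_bilinear).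
by rewrite -opprD opprK addrC (mulC (br x z)).
Qed.

Lemma reynolds_ns_comm_total x y :
  R (ns_comm_total ast cur x y) = mul (R x) (R y).
Proof.
by rewrite (reynolds_mul reynoldsR) /ns_comm_total /ast /cur (mulC (R y)).
Qed.

Lemma reynolds_ns_lie_total x y :
  R (ns_lie_total dia bul x y) = br (R x) (R y).
Proof.
by rewrite (reynolds_br reynoldsR) /ns_lie_total /dia /bul (br_skew x (R y)).
Qed.

Lemma reynolds_ns_commutative : is_ns_commutative ast cur.
Proof.
split.
- exact: bilinear_op_precomp.
- exact: bilinear_op_opp_precomp2.
- by move=> x y; rewrite /cur mulC.
- by move=> x y z; rewrite {3}/ast reynolds_ns_comm_total -mulA.
- have cur_total x y z :
      cur x (ns_comm_total ast cur y z) = - mul (R x) (mul (R y) (R z)).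
    by rewrite /cur reynolds_ns_comm_total.
  move=> x y z; rewrite !cur_total /ast /cur.
  by rewrite !(bilinear_opNr mul_bilinear) (poisson_mulCA (R x)).
Qed.

Lemma reynolds_ns_lie : is_ns_lie dia bul.
Proof.
split.
- exact: bilinear_op_precomp.
- exact: bilinear_op_opp_precomp2.
- by move=> x y; rewrite /bul br_skew.
- move=> x y z.
  (* The three terms with a product in the first slot of [dia] add up to the
     action of the total bracket. *)
  have dia_total :
      dia x (dia y z) - dia y (dia x z) =
      dia (dia x y) z - dia (dia y x) z + dia (bul x y) z.
    rewrite {1 3}/dia -poisson_br_adjoint -reynolds_ns_lie_total.
    rewrite /ns_lie_total /dia raddfD raddfB !(bilinear_opDl br_bilinear).
    by rewrite (bilinear_opNl br_bilinear).
  rewrite (addrAC (dia x _)) dia_total -addrA -[- _ + _]opprK opprD opprK.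
  by rewrite addrAC subrr add0r.
- have bul_total x y z :
      bul x (ns_lie_total dia bul y z) = - br (R x) (br (R y) (R z)).
    by rewrite /bul reynolds_ns_lie_total.
  move=> x y z; rewrite !bul_total /dia /bul.
  rewrite !(bilinear_opNr br_bilinear) -!opprD.
  (* The two halves of the sum are the same cyclic sum. *)
  have jac := lie_jacobi (poisson_lie poissonA) (R x) (R y) (R z).
  by rewrite jac add0r jac oppr0.
Qed.

End ReynoldsOperator.

Theorem proposition3p14 (k : fieldType) (k_char0 : [pchar k] =i pred0)
    (A : lmodType k) (mul br : A -> A -> A)
    (poissonA : is_poisson_algebra mul br)
    (R : {linear A -> A}) (reynoldsR : is_reynolds_operator mul br R) :
  is_ns_poisson
    (fun x y => mul (R x) y)
    (fun x y => - mul (R x) (R y))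
    (fun x y => br (R x) y)
    (fun x y => - br (R x) (R y)).
Proof.
split.
- exact: reynolds_ns_commutative poissonA _ reynoldsR.
- exact: reynolds_ns_lie poissonA _ reynoldsR.
- move=> x y z; rewrite (reynolds_ns_lie_total poissonA reynoldsR).
  by rewrite (poisson_leibniz poissonA) addrK.
- move=> x y z; rewrite (reynolds_ns_comm_total poissonA reynoldsR).
  exact: (poisson_leibniz_left poissonA).
- move=> x y z.
  rewrite (reynolds_ns_comm_total poissonA reynoldsR).
  rewrite !(reynolds_ns_lie_total poissonA reynoldsR).
  rewrite !(bilinear_opNr (lie_bilinear (poisson_lie poissonA))).
  rewrite !(bilinear_opNr (comm_assoc_bilinear (poisson_comm_assoc poissonA))).
  rewrite -!opprD (poisson_leibniz poissonA).
  rewrite (comm_assoc_comm (poisson_comm_assoc poissonA) (R z)).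
  by congr (- _); rewrite addrACA !addrA.
Qed.
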